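(* A function $\phi\colon \mathbb{R}\to\mathbb{R}$ is a maximal general dual-feasible function (gDFF) if and only if all of the following conditions hold: (i) $\phi(0)=0$; (ii) $\phi$ is superadditive, i.e. $\phi(x)+\phi(y)\le\phi(x+y)$ for all $x,y\in\mathbb{R}$; (iii) $\phi(x)\ge 0$ for all real $x\ge 0$; (iv) either $\phi(x)+\phi(1-x)=1$ for all $x\in\mathbb{R}$, or there is a real number $a$ with $0\le a<1$ such that $\phi(x)=ax$ for all $x\in\mathbb{R}$.
   Context: A function $\phi\colon\mathbb{R}\to\mathbb{R}$ is a (valid) general dual-feasible function (gDFF) if for every finite family $(x_i)_{i\in I}$ of real numbers (repetitions allowed), $\sum_{i\in I}x_i\le 1$ implies $\sum_{i\in I}\phi(x_i)\le 1$. A gDFF $\phi$ is maximal if there is no gDFF $\phi_1\ne\phi$ with $\phi_1(x)\ge\phi(x)$ for all $x\in\mathbb{R}$. *)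

(* Defs.v *)
From mathcomp Require Import all_boot all_order all_algebra.
From mathcomp Require Import reals.

Set Implicit Arguments.
Unset Strict Implicit.
Unset Printing Implicit Defensive.

Import Order.TTheory GRing.Theory Num.Theory.

Local Open Scope ring_scope.

Definition gDFF (R : realType) (phi : R -> R) : Prop :=
  forall (I : finType) (x : I -> R),
    \sum_(i : I) x i <= 1 -> \sum_(i : I) phi (x i) <= 1.

Definition maximal_gDFF (R : realType) (phi : R -> R) : Prop :=
  gDFF phi /\
  ~ (exists phi1 : R -> R,
       [/\ gDFF phi1, phi1 <> phi & forall x : R, phi1 x >= phi x]).

Definition superadditive (R : realType) (phi : R -> R) : Prop :=
  forall x y : R, phi x + phi y <= phi (x + y).

(* Main.v *)
Require Import Defs.
From mathcomp Require Import all_boot all_order all_algebra.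
From mathcomp Require Import boolp classical_sets reals.
From mathcomp Require Import lra.

Set Implicit Arguments.
Unset Strict Implicit.
Unset Printing Implicit Defensive.

Import Order.TTheory GRing.Theory Num.Theory.

Local Open Scope ring_scope.

(** Sufficiency: a superadditive function that vanishes at 0 and is nonnegative
on the nonnegative reals is nondecreasing, so it bounds the sum of its values
over a family of total at most 1 by its value at 1, which is at most 1.  A
symmetric function cannot be raised at x because the pair x, 1 - x is already
tight; the map a * x cannot be raised at x because a large number of copies of
x, balanced by one very negative entry, would accumulate the gain.

Necessity of the first three conditions: replacing phi x by the supremum of the
sums of phi over finite families of total at most x keeps phi dual-feasible
([packing_envelope_gDFF]), so a maximal phi equals its envelope, and therefore
bounds all these sums ([maximal_gDFF_sum_le]).

Necessity of the dichotomy: let phi be maximal with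
phi x0 + phi (1 - x0) < 1.  Raising phi at x0 alone by any e > 0 breaks
feasibility.  By superadditivity and monotonicity a violated family may be
taken to be n copies of x0 and one entry 1 - n x0, so the slack
D n = 1 - n phi x0 - phi (1 - n x0) is smaller than n e.  As D is nondecreasing
in n and D 1 > 0, such an n is large when e is small, and D n / n gets
arbitrarily close to 0 ([asymmetric_slack_lt]).  This almost-tightness has two
consequences.
- If x0 is nonzero, phi lies below the line through 0 and (x0, phi x0)
  ([asymmetric_linear_bound]): an excess of phi over the line at some x could be
  collected many times by exchanging copies of x0 for copies of x.
- Any line through 0 that lies above phi meets phi at x0 ([asymmetric_touch]):
  such a line bounds phi (1 - n x0), and a gap at x0 would force D n to grow
  linearly.
The points x0 and 1 - x0 violate symmetry together and are not both 0, so there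
is a line a * x above phi, and it meets phi at both.  Adding the two values gives
a = phi x0 + phi (1 - x0) < 1.  Hence a * x is itself dual-feasible, and by
maximality phi is that line. *)
(** * Superadditive functions *)

Lemma superadditive_nondecreasing (R : realType) (phi : R -> R) :
  superadditive phi -> (forall x, 0 <= x -> 0 <= phi x) ->
  {homo phi : x y / x <= y}.
Proof.
move=> phiD phi_ge0 x y lexy.
have := phiD x (y - x); rewrite subrKC; apply: le_trans.
by rewrite lerDl phi_ge0 // subr_ge0.
Qed.

Lemma superadditive_sum (R : realType) (phi : R -> R) :
  phi 0 = 0 -> superadditive phi ->
  forall (I : Type) (r : seq I) (P : pred I) (x : I -> R),
    \sum_(i <- r | P i) phi (x i) <= phi (\sum_(i <- r | P i) x i).
Proof.
move=> phi0 phiD I r P x; elim/big_rec2: _ => [|i u v _ leuv].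
  by rewrite phi0.
by apply: le_trans (phiD _ _); rewrite lerD2l.
Qed.

Lemma superadditive_mulrn (R : realType) (phi : R -> R) (x : R) (n : nat) :
  phi 0 = 0 -> superadditive phi -> n%:R * phi x <= phi (n%:R * x).
Proof.
move=> phi0 phiD.
have := superadditive_sum phi0 phiD (index_enum 'I_n) predT (fun=> x).
by rewrite !sumr_const card_ord !mulr_natl.
Qed.

Lemma superadditive_gDFF (R : realType) (phi : R -> R) :
  phi 0 = 0 -> superadditive phi -> (forall x, 0 <= x -> 0 <= phi x) ->
  phi 1 <= 1 -> gDFF phi.
Proof.
move=> phi0 phiD phi_ge0 phi1 I x lex1.
apply: le_trans phi1; apply: le_trans (superadditive_sum phi0 phiD _ _ _) _.
exact: superadditive_nondecreasing.
Qed.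

Lemma linear_gDFF (R : realType) (a : R) :
  0 <= a -> a <= 1 -> gDFF (fun x => a * x).
Proof.
move=> a_ge0 a_le1; apply: superadditive_gDFF => [|x y|x x_ge0|].
- by rewrite mulr0.
- by rewrite mulrDr.
- exact: mulr_ge0.
- by rewrite mulr1.
Qed.

(** * Dual-feasible and maximal functions *)

Lemma gDFF_seq (R : realType) (phi : R -> R) (s : seq R) :
  gDFF phi -> \sum_(x <- s) x <= 1 -> \sum_(x <- s) phi x <= 1.
Proof.
move=> gphi; rewrite big_tnth [X in _ -> X <= _]big_tnth.
exact: (gphi _ (tnth (in_tuple s))).
Qed.

Lemma gDFF_pair (R : realType) (phi : R -> R) (x : R) :
  gDFF phi -> phi x + phi (1 - x) <= 1.
Proof.
move=> gphi; have := @gDFF_seq _ phi [:: x; 1 - x] gphi.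
by rewrite !big_cons !big_nil !addr0 subrKC; apply.
Qed.

Lemma gDFF_multiple (R : realType) (phi : R -> R) (x : R) (n : nat) :
  gDFF phi -> n%:R * phi x + phi (1 - n%:R * x) <= 1.
Proof.
move=> gphi; have := @gDFF_seq _ phi (1 - n%:R * x :: nseq n x) gphi.
rewrite !big_cons !big_nseq !iter_addr_0 !mulr_natl subrK addrC.
by apply.
Qed.

Lemma maximal_gDFF_eq (R : realType) (phi psi : R -> R) :
  maximal_gDFF phi -> gDFF psi -> (forall x, phi x <= psi x) -> psi = phi.
Proof.
move=> [_ maxphi] gpsi lepsi; apply: contrapT => neq.
by apply: maxphi; exists psi.
Qed.

(** Finite families are represented by lists because the feasibility proof for
the envelope concatenates them. *)
Definition packing_values (R : realType) (phi : R -> R) (x : R) : set R :=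
  [set v | exists2 s : seq R, \sum_(y <- s) y <= x & v = \sum_(y <- s) phi y].

Definition packing_envelope (R : realType) (phi : R -> R) (x : R) : R :=
  sup (packing_values phi x).

(** The upper bound comes from adding the single entry 1 - x to a family of
total at most x, which gives a family of total at most 1. *)
Lemma packing_values_has_sup (R : realType) (phi : R -> R) (x : R) :
  gDFF phi -> has_sup (packing_values phi x).
Proof.
move=> gphi; split; first by exists (phi x), [:: x]; rewrite big_seq1.
exists (1 - phi (1 - x)) => _ [s sx ->].
have := @gDFF_seq _ phi (1 - x :: s) gphi; rewrite !big_cons.
by move=> /(_ ltac:(lra)); lra.
Qed.

Lemma packing_envelope_ge (R : realType) (phi : R -> R) (s : seq R) (x : R) :
  gDFF phi -> \sum_(y <- s) y <= x ->
  \sum_(y <- s) phi y <= packing_envelope phi x.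
Proof.
move=> gphi sx; apply: ub_le_sup; last by exists s.
by have [] := packing_values_has_sup x gphi.
Qed.

(** In a family of total at most 1, an entry x evaluated by the envelope can be
replaced by any family of total at most x evaluated by phi.  Doing this for one
entry after the other leads to a family evaluated by phi alone, hence the
mixed form of the induction. *)
Lemma packing_envelope_gDFF (R : realType) (phi : R -> R) :
  gDFF phi -> gDFF (packing_envelope phi).
Proof.
move=> gphi.
have envelope_le1 (t s : seq R) :
    \sum_(y <- t) y + \sum_(y <- s) y <= 1 ->
    \sum_(y <- t) packing_envelope phi y + \sum_(y <- s) phi y <= 1.
  elim: t s => [|x t IHt] s; first by rewrite !big_nil !add0r; apply: gDFF_seq.
  rewrite !big_cons => le1.
  suff : packing_envelope phi x <=
      1 - (\sum_(y <- t) packing_envelope phi y + \sum_(y <- s) phi y) by lra.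
  apply: ge_sup; first by have [] := packing_values_has_sup x gphi.
  move=> _ [u ux ->].
  by have := IHt (u ++ s); rewrite !big_cat /= => /(_ ltac:(lra)); lra.
move=> I x lex1.
have := envelope_le1 [seq x i | i <- index_enum I] [::].
by rewrite !big_map !big_nil !addr0; apply.
Qed.

(** A maximal phi is its own envelope.  Superadditivity, monotonicity and
nonnegativity are the cases of two, one and no entries. *)
Lemma maximal_gDFF_sum_le (R : realType) (phi : R -> R) (s : seq R) (x : R) :
  maximal_gDFF phi ->
  \sum_(y <- s) y <= x -> \sum_(y <- s) phi y <= phi x.
Proof.
move=> maxphi sx; have [gphi _] := maxphi.
rewrite -[leRHS](congr1 (@^~ x) (maximal_gDFF_eq maxphi
  (packing_envelope_gDFF gphi) _)) => [|y]; first exact: packing_envelope_ge.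
by have := @packing_envelope_ge _ phi [:: y] y gphi; rewrite !big_seq1; apply.
Qed.

Lemma maximal_gDFF_superadditive (R : realType) (phi : R -> R) :
  maximal_gDFF phi -> superadditive phi.
Proof.
move=> maxphi x y.
have := @maximal_gDFF_sum_le _ phi [:: x; y] (x + y) maxphi.
by rewrite !big_cons !big_nil !addr0; apply.
Qed.

Lemma maximal_gDFF_nonneg (R : realType) (phi : R -> R) (x : R) :
  maximal_gDFF phi -> 0 <= x -> 0 <= phi x.
Proof.
move=> maxphi; have := @maximal_gDFF_sum_le _ phi [::] x maxphi.
by rewrite !big_nil.
Qed.

Lemma maximal_gDFF0 (R : realType) (phi : R -> R) :
  maximal_gDFF phi -> phi 0 = 0.
Proof.
move=> maxphi; have := maximal_gDFF_nonneg maxphi (lexx 0).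
have := maximal_gDFF_superadditive maxphi 0 0; rewrite addr0; lra.
Qed.

(** * Maximal functions that are not symmetric *)

(** The amount by which the family of n copies of x and one 1 - n x, whose
total is exactly 1, fails to be tight. *)
Definition slack (R : realType) (phi : R -> R) (x : R) (n : nat) : R :=
  1 - (n%:R * phi x + phi (1 - n%:R * x)).

(** Passing from n to n + 1 splits 1 - n x into x and 1 - (n + 1) x, which by
superadditivity can only lower the sum. *)
Lemma slack_nondecreasing (R : realType) (phi : R -> R) (x : R) :
  superadditive phi -> {homo slack phi x : m n / (m <= n)%N >-> m <= n}.
Proof.
move=> phiD; apply: homo_leq => [//|y z u|n]; first exact: le_trans.
have := phiD x (1 - n.+1%:R * x); rewrite /slack -natr1.
rewrite (_ : x + _ = 1 - n%:R * x); last by lra.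
lra.
Qed.

(** Otherwise raising phi by e at x0 would keep it dual-feasible: in a family
that contains x0 exactly n times the gain is n e, while the other entries may be
merged into one and increased to 1 - n x0. *)
Lemma maximal_slack_lt (R : realType) (phi : R -> R) (x0 e : R) :
  maximal_gDFF phi -> 0 < e -> exists n, slack phi x0 n < n%:R * e.
Proof.
move=> maxphi e_gt0; apply: contrapT => noN.
have phiD := maximal_gDFF_superadditive maxphi.
have phi_ge0 x := maximal_gDFF_nonneg (x := x) maxphi.
have phi0 := maximal_gDFF0 maxphi.
pose psi x := if x == x0 then phi x0 + e else phi x.
have gpsi : gDFF psi.
  move=> I x lex1; rewrite (bigID (fun i => x i == x0)) /=.
  rewrite (eq_bigr (fun=> phi x0 + e)); last by move=> i; rewrite /psi => ->.
  rewrite [X in _ + X](eq_bigr (fun i => phi (x i))); last first.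
    by move=> i /negPf xi; rewrite /psi xi.
  rewrite sumr_const; set n := #|_|.
  have le_slack : n%:R * e <= slack phi x0 n.
    by rewrite leNgt; apply/negP => lt; apply: noN; exists n.
  move: lex1; rewrite (bigID (fun i => x i == x0)) /=.
  rewrite (eq_bigr (fun=> x0)); last by move=> i /eqP.
  rewrite sumr_const -/n -[x0 *+ n]mulr_natl -[(_ + e) *+ n]mulr_natl => lex1.
  have := superadditive_sum phi0 phiD (index_enum I) (fun i => x i != x0) x.
  have : phi (\sum_(i | x i != x0) x i) <= phi (1 - n%:R * x0).
    by apply: superadditive_nondecreasing => //; lra.
  by move: le_slack; rewrite /slack; lra.
have lepsi x : phi x <= psi x by rewrite /psi; case: eqP => [->|_]; lra.
have := congr1 (@^~ x0) (maximal_gDFF_eq maxphi gpsi lepsi).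
by rewrite /psi /= eqxx; lra.
Qed.

(** Asymmetry at x0 says that the slack is positive at n = 1, so it is bounded
below by d > 0 for all n > 0.  Shrinking e by a factor below 1 in the previous
lemma therefore gains any additive constant. *)
Lemma asymmetric_slack_lt (R : realType) (phi : R -> R) (x0 e c : R) :
  maximal_gDFF phi -> phi x0 + phi (1 - x0) < 1 -> 0 < e ->
  exists n, slack phi x0 n + c < n%:R * e.
Proof.
move=> maxphi asym e_gt0.
have phiD := maximal_gDFF_superadditive maxphi.
have d_gt0 : 0 < slack phi x0 1 by rewrite /slack !mul1r; lra.
set d := slack phi x0 1 in d_gt0.
have c_ge0 := normr_ge0 c; have c_le := ler_norm c.
have dc_gt0 : 0 < d + `|c| by lra.
(* With this factor n e exceeds (1 + |c| / d) D, where D >= d is the slack;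
   this is at least D + |c|. *)
have [|n] := @maximal_slack_lt _ phi x0 (e * (d / (d + `|c|))) maxphi.
  by rewrite mulr_gt0 // divr_gt0.
rewrite !mulrA ltr_pdivlMr // => lt_n; exists n.
(* The bound D >= d needs n > 0; n = 0 is excluded because phi 1 <= 1. *)
case: n lt_n => [|n] lt_n.
  have := gDFF_pair 0 maxphi.1; rewrite (maximal_gDFF0 maxphi) => le1.
  move: lt_n; rewrite !mul0r => lt_n.
  have : 0 <= slack phi x0 0 by rewrite /slack !mul0r; lra.
  by nra.
have le_d : d <= slack phi x0 n.+1 by apply: slack_nondecreasing.
rewrite -(ltr_pM2r d_gt0); apply: le_lt_trans lt_n.
by nra.
Qed.

(** Rounding y so that y z goes down: y itself goes down when z is nonnegative
and up when z is negative. *)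
Lemma ex_nat_multiple_le (R : realType) (y z : R) : 0 <= y ->
  exists j : nat, j%:R * z <= y * z <= j%:R * z + `|z|.
Proof.
move=> y_ge0; have /andP[ley lty] := truncn_itv y_ge0.
rewrite -natr1 in lty.
have [z_ge0|z_lt0] := leP 0 z.
  by exists (Num.truncn y); rewrite ger0_norm //; apply/andP; split; nra.
exists (Num.truncn y).+1; rewrite -natr1 ltr0_norm //.
by apply/andP; split; nra.
Qed.

(** Let h > 0 be the excess of phi x over a x, with a = phi x0 / x0, and start
from n copies of x0 and one entry 1 - n x0, where n is such that the slack is
small relative to n.  Exchange copies of x0 for about n / K copies of x of
nearly the same total, K being larger than |x / x0| so that enough copies of x0
are available.  The exchange gains h for each copy of x and loses at most
a |x0| by rounding; the net gain is more than the slack, so the sum exceeds 1. *)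
Lemma asymmetric_linear_bound (R : realType) (phi : R -> R) (x0 x : R) :
  maximal_gDFF phi -> phi x0 + phi (1 - x0) < 1 -> x0 != 0 ->
  0 <= phi x0 / x0 -> phi x <= phi x0 / x0 * x.
Proof.
move=> maxphi asym x0_neq0 a_ge0; set a := phi x0 / x0 in a_ge0 *.
have phi_x0 : phi x0 = a * x0 by rewrite /a divfK.
have phiD := maximal_gDFF_superadditive maxphi.
have phi_ge0 y := maximal_gDFF_nonneg (x := y) maxphi.
have phi0 := maximal_gDFF0 maxphi.
rewrite leNgt; apply/negP; rewrite -subr_gt0; set h := _ - _ => h_gt0.
pose K := (Num.truncn `|x / x0|).+1.
have ltK : `|x / x0| < K%:R by apply: truncnS_gt.
have K_gt0 : 0 < K%:R :> R by rewrite ltr0n.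
have [|n] := @asymmetric_slack_lt _ phi x0 (h / K%:R) (h + a * `|x0|) maxphi asym.
  by rewrite divr_gt0.
rewrite mulrA ltr_pdivlMr // => lt_n.
(* p copies of x replace copies of x0, of which j remain. *)
pose p := (n %/ K)%N.
have lepn : p%:R * K%:R <= n%:R :> R by rewrite -natrM ler_nat leq_divM.
have ltnp : n%:R < (p%:R + 1) * K%:R :> R.
  by rewrite natr1 -natrM ltr_nat ltn_ceil.
have y_ge0 : 0 <= n%:R - p%:R * (x / x0).
  have := ler_norm (x / x0); have := ler0n R p; nra.
have [j] := ex_nat_multiple_le x0 y_ge0.
rewrite mulrBl -mulrA divfK // => /andP[le_j ge_j].
have lephi : j%:R * phi x0 + p%:R * phi x + phi (1 - n%:R * x0) <= 1.
  have := superadditive_mulrn x0 j phi0 phiD.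
  have := superadditive_mulrn x p phi0 phiD.
  have := phiD (j%:R * x0) (p%:R * x).
  have := phiD (j%:R * x0 + p%:R * x) (1 - n%:R * x0).
  have : phi (j%:R * x0 + p%:R * x + (1 - n%:R * x0)) <= phi 1.
    by apply: superadditive_nondecreasing => //; lra.
  have := gDFF_pair 0 maxphi.1; rewrite phi0 subr0.
  by lra.
have le_ph : p%:R * h <= slack phi x0 n + a * `|x0|.
  by rewrite /slack /h; move: lephi; rewrite phi_x0; nra.
have : (h * (p%:R + 1)) * K%:R <= n%:R * h.
  by apply: le_trans (ltW lt_n); rewrite ler_pM2r //; lra.
by nra.
Qed.

(** If the line were above phi at x0 by h > 0, then its bound on phi (1 - n x0)
would make the slack at least n h + 1 - b for all n. *)
Lemma asymmetric_touch (R : realType) (phi : R -> R) (x0 b : R) :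
  maximal_gDFF phi -> phi x0 + phi (1 - x0) < 1 ->
  (forall x, phi x <= b * x) -> phi x0 = b * x0.
Proof.
move=> maxphi asym le_b; apply/eqP; rewrite eq_le le_b leNgt; apply/negP.
rewrite -subr_gt0 => h_gt0.
have [n] := asymmetric_slack_lt (b - 1) maxphi asym h_gt0.
by have := le_b (1 - n%:R * x0); rewrite /slack; lra.
Qed.

Lemma asymmetric_linear (R : realType) (phi : R -> R) (x0 : R) :
  maximal_gDFF phi -> phi x0 + phi (1 - x0) < 1 ->
  exists a, [/\ 0 <= a, a < 1 & forall x, phi x = a * x].
Proof.
move=> maxphi asym.
have phiD := maximal_gDFF_superadditive maxphi.
have phi_ge0 y := maximal_gDFF_nonneg (x := y) maxphi.
have phi0 := maximal_gDFF0 maxphi.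
have asymC : phi (1 - x0) + phi (1 - (1 - x0)) < 1 by rewrite subKr addrC.
have slope_ge0 z : 0 <= phi z / z.
  have [z_ge0|z_lt0] := leP 0 z; first by rewrite divr_ge0 ?phi_ge0.
  rewrite ler_ndivlMr // mul0r -phi0.
  by apply: superadditive_nondecreasing => //; exact: ltW.
have [a a_ge0 le_a] : exists2 a, 0 <= a & forall x, phi x <= a * x.
  have [x00|x0_neq0] := eqVneq x0 0; last first.
    by exists (phi x0 / x0) => // x; apply: asymmetric_linear_bound.
  exists (phi (1 - x0) / (1 - x0)) => // x; apply: asymmetric_linear_bound => //.
  by rewrite x00 subr0 oner_eq0.
have a_lt1 : a < 1.
  have := asymmetric_touch maxphi asym le_a.
  have := asymmetric_touch maxphi asymC le_a.
  by lra.
exists a; split=> // x.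
by rewrite -(maximal_gDFF_eq maxphi (linear_gDFF a_ge0 (ltW a_lt1)) le_a).
Qed.

(** * Sufficiency of the conditions *)

(** A larger dual-feasible psi satisfies psi x <= 1 - psi (1 - x)
<= 1 - phi (1 - x) = phi x. *)
Lemma symmetric_maximal (R : realType) (phi : R -> R) :
  gDFF phi -> (forall x, phi x + phi (1 - x) = 1) -> maximal_gDFF phi.
Proof.
move=> gphi sym; split=> // -[psi [gpsi neq le_psi]]; apply: neq.
apply/funext => x; apply/eqP; rewrite eq_le le_psi andbT.
have := gDFF_pair x gpsi; have := sym x; have := le_psi (1 - x); lra.
Qed.

(** If psi exceeds the line at x by h > 0, then n copies of x and one 1 - n x
give at least a + n h, which is larger than 1 once n h > 1. *)
Lemma linear_maximal (R : realType) (a : R) :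
  0 <= a -> a <= 1 -> maximal_gDFF (fun x => a * x).
Proof.
move=> a_ge0 a_le1; split; first exact: linear_gDFF.
move=> [psi [gpsi neq le_psi]]; apply: neq; apply/funext => x.
apply/eqP; rewrite eq_le le_psi andbT leNgt; apply/negP.
rewrite -subr_gt0 => h_gt0.
have := truncnS_gt (1 / (psi x - a * x)); set n := _.+1.
rewrite ltr_pdivrMr // => lt_n.
have := gDFF_multiple x n gpsi; have := le_psi (1 - n%:R * x); nra.
Qed.

Theorem theorem4 (R : realType) (phi : R -> R) :
  maximal_gDFF phi <->
  [/\ phi 0 = 0,
      superadditive phi,
      (forall x : R, 0 <= x -> 0 <= phi x) &
      (forall x : R, phi x + phi (1 - x) = 1) \/
      (exists a : R, [/\ 0 <= a, a < 1 & forall x : R, phi x = a * x])].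
Proof.
split=> [maxphi|[phi0 phiD phi_ge0 [sym|[a [a_ge0 a_lt1 phiE]]]]].
- split; [exact: maximal_gDFF0|exact: maximal_gDFF_superadditive| |].
    by move=> x; apply: maximal_gDFF_nonneg.
  have [sym|/existsNP[x0 asym]] := pselect (forall x, phi x + phi (1 - x) = 1).
    by left.
  right; apply: (asymmetric_linear (x0 := x0) maxphi).
  by rewrite lt_neqAle gDFF_pair ?andbT; [apply/eqP|case: maxphi].
- apply: symmetric_maximal => //; apply: superadditive_gDFF => //.
  by have := sym 0; rewrite phi0 subr0; lra.
- rewrite (_ : phi = fun x => a * x); last exact/funext.
  by apply: linear_maximal => //; exact: ltW.
Qed.
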